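(* Let $(A,\mu,\alpha,\beta)$ be a BiHom-associative algebra such that $\alpha,\beta$ are bijective, and let $\psi,\omega:A\to A$ be linear maps such that any two of $\alpha,\beta,\psi,\omega$ commute and $\psi(ab)=\psi(a)\psi(b)$, $\omega(ab)=\omega(a)\omega(b)$ for all $a,b\in A$. Let $r,s\in A\otimes A$ be $\alpha,\beta,\psi,\omega$-invariant, and define linear maps $\delta_r,\delta_s,\Delta:A\to A\otimes A$ by $$\delta_{r}(a)=\alpha^{-1}(a)\triangleright r-r\triangleleft\beta^{-1}(a),\quad \delta_{s}(a)=\alpha^{-1}(a)\triangleright s-s\triangleleft\beta^{-1}(a),\quad \Delta(a)=\alpha^{-1}(a)\triangleright r-s\triangleleft\beta^{-1}(a).$$ Then $(A,\mu,\delta_{r},\delta_{s},\Delta,\alpha,\beta,\psi,\omega)$ is a covariant BiHom-bialgebra if and only if, for all $a\in A$, $$\omega\alpha^{-1}(a)\triangleright(r_{13}r_{12}-r_{12}r_{23}+s_{23}r_{13})=(s_{13}r_{12}-s_{12}s_{23}+s_{23}s_{13})\triangleleft\psi\beta^{-1}(a).$$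
   Context: $K$ is a field; everything is $K$-linear; elements of $A\otimes A$ are written $r=r^1\otimes r^2$ with summation understood, and juxtaposition of maps denotes composition. A BiHom-associative algebra $(A,\mu,\alpha,\beta)$ is a vector space $A$ with linear maps $\mu:A\otimes A\to A$, $\mu(a\otimes b)=ab$, and $\alpha,\beta:A\to A$ with $\alpha\beta=\beta\alpha$, $\alpha(ab)=\alpha(a)\alpha(b)$, $\beta(ab)=\beta(a)\beta(b)$, $\alpha(a)(bc)=(ab)\beta(c)$. A BiHom-coassociative coalgebra $(A,\Delta,\psi,\omega)$: $\psi\omega=\omega\psi$, $(\psi\otimes\psi)\Delta=\Delta\psi$, $(\omega\otimes\omega)\Delta=\Delta\omega$, $(\Delta\otimes\psi)\Delta=(\omega\otimes\Delta)\Delta$. Actions: $a\triangleright(x\otimes y)=\omega(a)x\otimes\beta(y)$, $(x\otimes y)\triangleleft a=\alpha(x)\otimes y\psi(a)$, $a\triangleright(x\otimes y\otimes z)=\omega(a)x\otimes\beta(y)\otimes\beta(z)$, $(x\otimes y\otimes z)\triangleleft a=\alpha(x)\otimes\alpha(y)\otimes z\psi(a)$. $r$ is $F$-invariant if $(F\otimes F)(r)=r$. For $r,s\in A\otimes A$ (independent copies if equal): $r_{12}s_{23}=\alpha(r^{1})\otimes r^{2}s^{1}\otimes\beta(s^{2})$, $\;r_{13}s_{12}=\omega(r^{1})s^{1}\otimes\beta(s^{2})\otimes\alpha\psi(r^{2})$, $\;r_{23}s_{13}=\beta\omega(s^{1})\otimes\alpha(r^{1})\otimes r^{2}\psi(s^{2})$.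 A BiHom-derivation is a linear map $\delta:A\to A\otimes A$ with $(F\otimes F)\delta=\delta F$ for $F\in\{\alpha,\beta,\psi,\omega\}$ and $\delta(ab)=a\triangleright\delta(b)+\delta(a)\triangleleft b$. A covariant BiHom-bialgebra $(A,\mu,\delta_1,\delta_2,\Delta,\alpha,\beta,\psi,\omega)$: $\delta_1,\delta_2$ are BiHom-derivations, $(A,\mu,\alpha,\beta)$ is a BiHom-associative algebra, $(A,\Delta,\psi,\omega)$ is a BiHom-coassociative coalgebra, $\Delta(ab)=\Delta(a)\triangleleft b+a\triangleright\delta_1(b)=a\triangleright\Delta(b)+\delta_2(a)\triangleleft b$ for all $a,b$, each of $\psi,\omega$ commutes with each of $\alpha,\beta$, $(\alpha\otimes\alpha)\Delta=\Delta\alpha$, $(\beta\otimes\beta)\Delta=\Delta\beta$, and $\psi,\omega$ are multiplicative for $\mu$. *)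

(* Defs.v *)
From HB Require Import structures.
From mathcomp Require Import all_boot all_order all_algebra.
From mathcomp Require Import boolp.

Set Implicit Arguments.
Unset Strict Implicit.
Unset Printing Implicit Defensive.

Import GRing.Theory.

Local Open Scope ring_scope.
Local Open Scope quotient_scope.

Reserved Notation "x \ot y" (at level 40, left associativity).

(* The list [:: (x_1, y_1); ...; (x_n, y_n)] stands for the formal sum of the
   x_i (x) y_i; [tens_rel] is the congruence generated by commutativity of the
   sum, additivity in each argument and K-balancedness.  Scalars and opposites
   act on the first components, so no formal coefficients are needed; the rule
   [tens_rel_zero] is not implied by the others, as the empty sum would
   otherwise only be equivalent to itself. *)
Inductive tens_rel (K : fieldType) (V W : lmodType K) :
    seq (V * W) -> seq (V * W) -> Prop :=
  | tens_rel_refl s : tens_rel s s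
  | tens_rel_sym s t : tens_rel s t -> tens_rel t s
  | tens_rel_trans t s u : tens_rel s t -> tens_rel t u -> tens_rel s u
  | tens_rel_cat s s' t t' :
      tens_rel s s' -> tens_rel t t' -> tens_rel (s ++ t) (s' ++ t')
  | tens_rel_comm s t : tens_rel (s ++ t) (t ++ s)
  | tens_rel_addl x x' y : tens_rel [:: (x + x', y)] [:: (x, y); (x', y)]
  | tens_rel_addr x y y' : tens_rel [:: (x, y + y')] [:: (x, y); (x, y')]
  | tens_rel_scale a x y : tens_rel [:: (a *: x, y)] [:: (x, a *: y)]
  | tens_rel_zero y : tens_rel [:: (0, y)] [::].

Definition tens_relb (K : fieldType) (V W : lmodType K)
  (s t : seq (V * W)) : bool := `[< tens_rel s t >].

Section TensorProduct.
Context (K : fieldType) (V W : lmodType K).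

Lemma tens_relb_equiv : equivalence_rel (@tens_relb K V W).
Proof.
move=> s t u; split; first by apply/asboolP; apply: tens_rel_refl.
move=> /asboolP st; apply/asboolP/asboolP.
  by apply: tens_rel_trans; apply: tens_rel_sym.
exact: tens_rel_trans.
Qed.

Lemma tens_relb_refl : reflexive (@tens_relb K V W).
Proof. by move=> s; case: (tens_relb_equiv s s s). Qed.

Lemma tens_relb_sym : symmetric (@tens_relb K V W).
Proof.
by move=> s t; apply/asboolP/asboolP; apply: tens_rel_sym.
Qed.

Lemma tens_relb_trans : transitive (@tens_relb K V W).
Proof.
move=> t s u /asboolP st /asboolP tu; apply/asboolP.
exact: tens_rel_trans st tu.
Qed.

Canonical tens_equiv := EquivRel (@tens_relb K V W)
  tens_relb_refl tens_relb_sym tens_relb_trans.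

Definition tensor := {eq_quot tens_equiv}.

HB.instance Definition _ := Choice.on tensor.

Definition tclass (s : seq (V * W)) : tensor := \pi_({eq_quot tens_equiv}) s.
Definition trepr (t : tensor) : seq (V * W) :=
  repr (t : {eq_quot tens_equiv}).

Definition pure (x : V) (y : W) : tensor := tclass [:: (x, y)].

Definition tens_scale_seq (a : K) (s : seq (V * W)) :=
  [seq (a *: p.1, p.2) | p <- s].

Definition tens_zero : tensor := tclass [::].
Definition tens_add (t u : tensor) : tensor := tclass (trepr t ++ trepr u).
Definition tens_scale (a : K) (t : tensor) : tensor :=
  tclass (tens_scale_seq a (trepr t)).
Definition tens_opp (t : tensor) : tensor := tens_scale (-1) t.

Lemma treprK t : tclass (trepr t) = t.
Proof. exact: (@reprK _ {eq_quot tens_equiv}). Qed.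

Lemma tclassP s t : tclass s = tclass t <-> tens_rel s t.
Proof.
split=> [st|st]; last by apply/eqmodP/asboolP.
by have /eqmodP/asboolP := st.
Qed.

Lemma trepr_class s : tens_rel (trepr (tclass s)) s.
Proof. by apply/tclassP; rewrite treprK. Qed.

Lemma tens_rel_scale_seq a s t :
  tens_rel s t -> tens_rel (tens_scale_seq a s) (tens_scale_seq a t).
Proof.
elim=> {s t}.
- by move=> s; apply: tens_rel_refl.
- by move=> s t _; apply: tens_rel_sym.
- by move=> t s u _ st _ tu; apply: tens_rel_trans st tu.
- by move=> s s' t t' _ ss' _ tt'; rewrite /tens_scale_seq !map_cat; apply: tens_rel_cat.
- by move=> s t; rewrite /tens_scale_seq !map_cat; apply: tens_rel_comm.
- by move=> x x' y; rewrite /= scalerDr; apply: tens_rel_addl.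
- by move=> x y y'; apply: tens_rel_addr.
- by move=> b x y; rewrite /= scalerA mulrC -scalerA; apply: tens_rel_scale.
- by move=> y; rewrite /= scaler0; apply: tens_rel_zero.
Qed.

Lemma tclass_cat s t : tclass (s ++ t) = tens_add (tclass s) (tclass t).
Proof.
by apply/tclassP; apply: tens_rel_cat; apply/tens_rel_sym/trepr_class.
Qed.

Lemma tclass_scale a s :
  tclass (tens_scale_seq a s) = tens_scale a (tclass s).
Proof.
by apply/tclassP/tens_rel_scale_seq/tens_rel_sym/trepr_class.
Qed.

Lemma tens_addA : associative tens_add.
Proof.
move=> t u v; rewrite -[t]treprK -[u]treprK -[v]treprK.
by rewrite -!tclass_cat catA.
Qed.

Lemma tens_addC : commutative tens_add.
Proof.
move=> t u; rewrite -[t]treprK -[u]treprK -!tclass_cat.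
exact/tclassP/tens_rel_comm.
Qed.

Lemma tens_add0 : left_id tens_zero tens_add.
Proof. by move=> t; rewrite -[t]treprK -tclass_cat. Qed.

Lemma tens_scaleDl t a b :
  tens_scale (a + b) t = tens_add (tens_scale a t) (tens_scale b t).
Proof.
rewrite -[t]treprK -!tclass_scale -tclass_cat; apply/tclassP.
elim: (trepr t) => [|[x y] s IHs]; first exact: tens_rel_refl.
rewrite /= scalerDl -cat1s.
apply: tens_rel_trans (tens_rel_cat (tens_rel_addl _ _ _) IHs) _.
rewrite /= -cat1s -[X in tens_rel _ X]cat1s.
apply: tens_rel_cat; first exact: tens_rel_refl.
rewrite -cat1s -[X in tens_rel _ (_ ++ X)]cat1s !catA.
by apply: tens_rel_cat; [apply: tens_rel_comm | apply: tens_rel_refl].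
Qed.

Lemma tens_scale0 t : tens_scale 0 t = tens_zero.
Proof.
rewrite -[t]treprK -tclass_scale; apply/tclassP.
elim: (trepr t) => [|[x y] s IHs]; first exact: tens_rel_refl.
rewrite /= scale0r -cat1s.
exact: (@tens_rel_cat _ _ _ _ [::] _ [::] (tens_rel_zero _ _) IHs).
Qed.

Lemma tens_scale1 : left_id 1 tens_scale.
Proof.
move=> t; rewrite -[t]treprK -tclass_scale; congr tclass.
by rewrite /tens_scale_seq -[RHS]map_id; apply: eq_map => -[x y]; rewrite /= scale1r.
Qed.

Lemma tens_addN : left_inverse tens_zero tens_opp tens_add.
Proof.
move=> t; rewrite -{2}[t]tens_scale1 -tens_scaleDl addNr.
exact: tens_scale0.
Qed.

HB.instance Definition _ :=
  GRing.isZmodule.Build tensor tens_addA tens_addC tens_add0 tens_addN.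

Lemma tens_scaleA a b t : tens_scale a (tens_scale b t) = tens_scale (a * b) t.
Proof.
rewrite -[t]treprK -!tclass_scale; congr tclass.
by rewrite /tens_scale_seq -map_comp; apply: eq_map => -[x y]; rewrite /= scalerA.
Qed.

Lemma tens_scaleDr : right_distributive tens_scale +%R.
Proof.
rewrite -[+%R]/tens_add; move=> a t u; rewrite -[t]treprK -[u]treprK -tclass_cat -!tclass_scale.
by rewrite /tens_scale_seq map_cat tclass_cat.
Qed.

HB.instance Definition _ := GRing.Zmodule_isLmodule.Build K tensor
  tens_scaleA tens_scale1 tens_scaleDr tens_scaleDl.

(* The linear map V (x) W -> X induced by f : V -> W -> X; it is meaningful
   only for bilinear f (see [tlift_pure] and [tlift_linear]).  The expression
   [tlift (fun t1 t2 => E) t] renders the Sweedler-style E(t^1, t^2). *)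
Definition tlift (X : lmodType K) (f : V -> W -> X) (t : tensor) : X :=
  \sum_(p <- trepr t) f p.1 p.2.

End TensorProduct.

Arguments tensor {K} (V W)%_type_scope.

Notation "V \ot W" := (tensor V W) : type_scope.
Notation "x \ot y" := (pure x y) : ring_scope.

Notation bilinear_map f := (bilinear_for *:%R *:%R f).

Section TensorTheory.
Context (K : fieldType).
Implicit Types V W X : lmodType K.

Lemma tclassD V W (s t : seq (V * W)) :
  tclass (s ++ t) = tclass s + tclass t.
Proof. exact: tclass_cat. Qed.

Lemma tclassZ V W a (s : seq (V * W)) :
  tclass (tens_scale_seq a s) = a *: tclass s.
Proof. exact: tclass_scale. Qed.

Lemma pure_bilinear V W : bilinear_map (@pure K V W).
Proof.
split=> [y a x x'|x a y y']; rewrite /= /pure -tclassZ -tclassD; apply/tclassP.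
  exact: tens_rel_addl.
apply: tens_rel_trans (tens_rel_addr _ _ _) _.
rewrite -cat1s; apply: tens_rel_cat (tens_rel_refl [:: (x, y')]).
exact/tens_rel_sym/tens_rel_scale.
Qed.

HB.instance Definition _ V W :=
  bilinear_isBilinear.Build K V W (V \ot W)%type *:%R *:%R (@pure K V W)
    (@pure_bilinear V W).

Lemma tclassE V W (s : seq (V * W)) :
  tclass s = \sum_(p <- s) p.1 \ot p.2.
Proof.
elim: s => [|[x y] s IHs]; first by rewrite big_nil.
by rewrite big_cons -IHs -cat1s tclassD.
Qed.

Lemma tensorE V W (t : V \ot W) : t = \sum_(p <- trepr t) p.1 \ot p.2.
Proof. by rewrite -tclassE treprK. Qed.

Lemma tens_rel_sum V W X (f : V -> W -> X) (s t : seq (V * W)) :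
  bilinear_map f -> tens_rel s t ->
  \sum_(p <- s) f p.1 p.2 = \sum_(p <- t) f p.1 p.2.
Proof.
case=> fl fr; elim=> {s t}.
- by [].
- by move=> s t _ ->.
- by move=> t s u _ -> _ ->.
- by move=> s s' t t' _ + _; rewrite !big_cat /= => -> ->.
- by move=> s t; rewrite !big_cat /= addrC.
- move=> x x' y; rewrite !big_cons !big_nil /= !addr0.
  by have := fl y 1 x x'; rewrite /= !scale1r.
- move=> x y y'; rewrite !big_cons !big_nil /= !addr0.
  by have := fr x 1 y y'; rewrite /= !scale1r.
- move=> a x y; rewrite !big_cons !big_nil /= !addr0.
  have fl0 : f 0 y = 0 by have := fl y (-1) 0 0; rewrite /= scaler0 addr0 scaleN1r addNr.
  have fr0 : f x 0 = 0 by have := fr x (-1) 0 0; rewrite /= scaler0 addr0 scaleN1r addNr.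
  have := fl y a x 0; rewrite /= !addr0 fl0 addr0 => ->.
  by have := fr x a y 0; rewrite /= !addr0 fr0 addr0 => ->.
- move=> y; rewrite big_cons !big_nil /= addr0.
  by have := fl y (-1) 0 0; rewrite /= scaler0 addr0 scaleN1r addNr.
Qed.

Lemma tlift_class V W X (f : V -> W -> X) (s : seq (V * W)) :
  bilinear_map f -> tlift f (tclass s) = \sum_(p <- s) f p.1 p.2.
Proof. by move=> fP; apply: tens_rel_sum fP (trepr_class s). Qed.

Lemma tlift_pure V W X (f : V -> W -> X) x y :
  bilinear_map f -> tlift f (x \ot y) = f x y.
Proof. by move=> fP; rewrite tlift_class// big_seq1. Qed.

Lemma tlift_linear V W X (f : V -> W -> X) :
  bilinear_map f -> linear (tlift f).
Proof.
move=> fP a t u; rewrite -[t]treprK -[u]treprK.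
rewrite -tclassZ -tclassD !tlift_class// big_cat /=.
congr (_ + _); rewrite /tens_scale_seq big_map scaler_sumr.
apply: eq_bigr => p _ /=; case: fP => fl _.
have fl0 : f 0 p.2 = 0
  by have := fl p.2 (-1) 0 0; rewrite /= scaler0 addr0 scaleN1r addNr.
by have := fl p.2 a p.1 0; rewrite /= !addr0 fl0 addr0.
Qed.

Lemma eq_linear_pure V W X (f g : {linear (V \ot W)%type -> X}) :
  (forall x y, f (x \ot y) = g (x \ot y)) -> f =1 g.
Proof.
move=> fg t; rewrite [t]tensorE !linear_sum.
by apply: eq_bigr => p _; apply: fg.
Qed.

Lemma tlift_unique V W X (f : V -> W -> X) (g : {linear (V \ot W)%type -> X}) :
  (forall x y, g (x \ot y) = f x y) -> g =1 tlift f.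
Proof.
move=> gf t; rewrite [t in LHS]tensorE linear_sum.
by apply: eq_bigr => p _; apply: gf.
Qed.

End TensorTheory.

Definition tmap (K : fieldType) (V V' W W' : lmodType K)
    (f : V -> V') (g : W -> W') : V \ot W -> V' \ot W' :=
  tlift (fun x y => f x \ot g y).

(* Iterated tensor products are bracketed to the left; [tassoc] is the
   identification of V (x) (W (x) X) with (V (x) W) (x) X. *)
Definition tassoc (K : fieldType) (V W X : lmodType K) :
    V \ot (W \ot X) -> V \ot W \ot X :=
  tlift (fun x => tlift (fun y z => x \ot y \ot z)).

Section TmapTheory.
Context (K : fieldType) (V V' W W' X : lmodType K).

Lemma tmap_bilinear (f : {linear V -> V'}) (g : {linear W -> W'}) :
  bilinear_map (fun x y => f x \ot g y).
Proof.
split=> [y a x x'|x a y y'] /=; rewrite linearP ?linearPl//.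
by case: (@pure_bilinear _ V' W') => _ /(_ (f x) a (g y) (g y')).
Qed.

Lemma tmap_pure (f : {linear V -> V'}) (g : {linear W -> W'}) x y :
  tmap f g (x \ot y) = f x \ot g y.
Proof. exact/tlift_pure/tmap_bilinear. Qed.

Lemma tmap_linear (f : {linear V -> V'}) (g : {linear W -> W'}) :
  linear (tmap f g).
Proof. exact/tlift_linear/tmap_bilinear. Qed.

Lemma tassoc_inner_bilinear (x : V) :
  bilinear_map (fun (y : W) (z : X) => x \ot y \ot z).
Proof.
have [_ pr] := @pure_bilinear K V W.
have [ql qr] := @pure_bilinear K (V \ot W)%type X.
by split=> [z a y y'|y a z z'] /=; [rewrite pr; apply: ql | apply: qr].
Qed.

Lemma tassoc_bilinear :
  bilinear_map (fun x : V => tlift (fun (y : W) (z : X) => x \ot y \ot z)).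
Proof.
split=> [t a x x'|x]; last exact/tlift_linear/tassoc_inner_bilinear.
rewrite /= /tlift scaler_sumr -big_split; apply: eq_bigr => p _ /=.
have [pl _] := @pure_bilinear K V W.
have [ql _] := @pure_bilinear K (V \ot W)%type X.
by have /= -> := pl p.1 a x x'; apply: ql.
Qed.

Lemma tassoc_linear : linear (@tassoc K V W X).
Proof. exact/tlift_linear/tassoc_bilinear. Qed.

Lemma tassoc_pure (x : V) (y : W) (z : X) :
  tassoc (x \ot (y \ot z)) = x \ot y \ot z.
Proof.
rewrite /tassoc tlift_pure; last exact: tassoc_bilinear.
by rewrite tlift_pure//; apply: tassoc_inner_bilinear.
Qed.

End TmapTheory.

Record bihom_associative (K : fieldType) (A : lmodType K)
    (mu : {linear (A \ot A)%type -> A}) (alpha beta : {linear A -> A}) : Prop :=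
  BiHomAssociative {
    bihom_alpha_beta : forall a, alpha (beta a) = beta (alpha a);
    bihom_alphaM : forall a b, alpha (mu (a \ot b)) = mu (alpha a \ot alpha b);
    bihom_betaM : forall a b, beta (mu (a \ot b)) = mu (beta a \ot beta b);
    bihom_mulA : forall a b c,
      mu (alpha a \ot mu (b \ot c)) = mu (mu (a \ot b) \ot beta c)
  }.

Record bihom_coassociative (K : fieldType) (A : lmodType K)
    (Delta : A -> A \ot A) (psi omega : {linear A -> A}) : Prop :=
  BiHomCoassociative {
    bihom_Delta_linear : linear Delta;
    bihom_psi_omega : forall a, psi (omega a) = omega (psi a);
    bihom_psi_Delta : forall a, tmap psi psi (Delta a) = Delta (psi a);
    bihom_omega_Delta : forall a, tmap omega omega (Delta a) = Delta (omega a);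
    bihom_comulA : forall a,
      tmap Delta psi (Delta a) = tassoc (tmap omega Delta (Delta a))
  }.

Section Actions.
Context (K : fieldType) (A : lmodType K).
Implicit Types (mu : {linear (A \ot A)%type -> A}).
Implicit Types (alpha beta psi omega : {linear A -> A}).

Definition lact2 mu beta omega (a : A) : A \ot A -> A \ot A :=
  tmap (fun x => mu (omega a \ot x)) beta.

Definition ract2 mu alpha psi (t : A \ot A) (a : A) : A \ot A :=
  tmap alpha (fun y => mu (y \ot psi a)) t.

Definition lact3 mu beta omega (a : A) : A \ot A \ot A -> A \ot A \ot A :=
  tmap (tmap (fun x => mu (omega a \ot x)) beta) beta.

Definition ract3 mu alpha psi (t : A \ot A \ot A) (a : A) : A \ot A \ot A :=
  tmap (tmap alpha alpha) (fun z => mu (z \ot psi a)) t.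

(* The first tensor carries the first pair of legs: [mul23_13 r s] is
   r_23 s_13, and similarly for the other two. *)
Definition mul12_23 mu alpha beta (r s : A \ot A) : A \ot A \ot A :=
  tlift (fun r1 r2 => tlift (fun s1 s2 =>
    alpha r1 \ot mu (r2 \ot s1) \ot beta s2) s) r.

Definition mul13_12 mu alpha beta psi omega (r s : A \ot A) : A \ot A \ot A :=
  tlift (fun r1 r2 => tlift (fun s1 s2 =>
    mu (omega r1 \ot s1) \ot beta s2 \ot alpha (psi r2)) s) r.

Definition mul23_13 mu alpha beta psi omega (r s : A \ot A) : A \ot A \ot A :=
  tlift (fun r1 r2 => tlift (fun s1 s2 =>
    beta (omega s1) \ot alpha r1 \ot mu (r2 \ot psi s2)) s) r.

Definition invariant_tensor (F : {linear A -> A}) (r : A \ot A) : Prop :=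
  tmap F F r = r.

(* [alphaV] and [betaV] stand for the inverses of alpha and beta; the maps
   delta_r, delta_s and Delta are the cases (r, r), (s, s) and (r, s). *)
Definition coboundary mu alpha beta psi omega (alphaV betaV : A -> A)
    (r s : A \ot A) (a : A) : A \ot A :=
  lact2 mu beta omega (alphaV a) r - ract2 mu alpha psi s (betaV a).

End Actions.

Record bihom_derivation (K : fieldType) (A : lmodType K)
    (mu : {linear (A \ot A)%type -> A}) (alpha beta psi omega : {linear A -> A})
    (delta : A -> A \ot A) : Prop := BiHomDerivation {
  bihom_der_linear : linear delta;
  bihom_der_alpha : forall a, tmap alpha alpha (delta a) = delta (alpha a);
  bihom_der_beta : forall a, tmap beta beta (delta a) = delta (beta a);
  bihom_der_psi : forall a, tmap psi psi (delta a) = delta (psi a);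
  bihom_der_omega : forall a, tmap omega omega (delta a) = delta (omega a);
  bihom_derM : forall a b, delta (mu (a \ot b)) =
    lact2 mu beta omega a (delta b) + ract2 mu alpha psi (delta a) b
}.

Record covariant_bihom_bialgebra (K : fieldType) (A : lmodType K)
    (mu : {linear (A \ot A)%type -> A}) (delta1 delta2 Delta : A -> A \ot A)
    (alpha beta psi omega : {linear A -> A}) : Prop := CovariantBiHomBialgebra {
  cbb_der1 : bihom_derivation mu alpha beta psi omega delta1;
  cbb_der2 : bihom_derivation mu alpha beta psi omega delta2;
  cbb_assoc : bihom_associative mu alpha beta;
  cbb_coassoc : bihom_coassociative Delta psi omega;
  cbb_DeltaM1 : forall a b, Delta (mu (a \ot b)) =
    ract2 mu alpha psi (Delta a) b + lact2 mu beta omega a (delta1 b);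
  cbb_DeltaM2 : forall a b, Delta (mu (a \ot b)) =
    lact2 mu beta omega a (Delta b) + ract2 mu alpha psi (delta2 a) b;
  cbb_psi_alpha : forall a, psi (alpha a) = alpha (psi a);
  cbb_psi_beta : forall a, psi (beta a) = beta (psi a);
  cbb_omega_alpha : forall a, omega (alpha a) = alpha (omega a);
  cbb_omega_beta : forall a, omega (beta a) = beta (omega a);
  cbb_alpha_Delta : forall a, tmap alpha alpha (Delta a) = Delta (alpha a);
  cbb_beta_Delta : forall a, tmap beta beta (Delta a) = Delta (beta a);
  cbb_psiM : forall a b, psi (mu (a \ot b)) = mu (psi a \ot psi b);
  cbb_omegaM : forall a b, omega (mu (a \ot b)) = mu (omega a \ot omega b)
}.

(* Main.v *)
Require Import Defs.
From HB Require Import structures.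
From mathcomp Require Import all_boot all_order all_algebra.

Set Implicit Arguments.
Unset Strict Implicit.
Unset Printing Implicit Defensive.

Import GRing.Theory.

Local Open Scope ring_scope.

(** Write x y for the product, u for the image of a under the inverse of alpha
and v for its image under the inverse of beta, so that

    Delta(a) = omega(u) r1 (x) beta(r2) - alpha(s1) (x) s2 psi(v).

Every axiom of a covariant BiHom-bialgebra except the coassociativity of Delta
holds with no condition linking r and s.  Compatibility with alpha, beta, psi
and omega is [coboundary_comm].  The derivation property of delta_r and
delta_s and both formulas for Delta(ab) are instances of one identity, valid
for three tensors x, y, z ([coboundaryM]):

    d_{x,y}(ab) = a |> d_{x,z}(b) + d_{z,y}(a) <| b.

It holds because the two terms that z contributes are equal and of opposite
signs, while BiHom-associativity and invariance turn the remaining terms into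
those of the left-hand side.

Coassociativity is thus the only remaining condition, and its defect at a,
(Delta (x) psi)Delta(a) - (omega (x) Delta)Delta(a), is exactly the difference
of the two sides of the stated equation at a ([coassociativity_defect]).  Each
of the two composites expands into four terms, each a multilinear expression
in the legs of two copies of r or s ([comul_coboundary_left],
[comul_coboundary_right]).  One term on each side carries, in the middle leg,
the image of a under both inverses, and these two terms are equal
([mixed_terms_cancel]).  The other six are, one by
one, the three products on the left acted on from the left and the three
products on the right acted on from the right.

All these identifications work in the same way.  The two expressions agree up
to structure maps applied to the legs of r or s; invariance permits inserting
such a map on both legs of a tensor at once ([tlift2_invl], [tlift2_invr]), and
once the right maps are inserted the expressions agree leg by leg, by
BiHom-associativity and the commutation of the structure maps. *)

(** * Multilinear expressions in the legs of tensors *)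

Section MultilinearExpressions.
Context (K : fieldType).
Implicit Types V W X Y : lmodType K.

Lemma pure_linl V W (y : W) a (x x' : V) :
  (a *: x + x') \ot y = a *: (x \ot y) + x' \ot y.
Proof. by have [pl _] := @pure_bilinear K V W; apply: pl. Qed.

Lemma pure_linr V W (x : V) a (y y' : W) :
  x \ot (a *: y + y') = a *: (x \ot y) + x \ot y'.
Proof. by have [_ pr] := @pure_bilinear K V W; apply: pr. Qed.

Lemma eq_tlift V W X (f g : V -> W -> X) t : f =2 g -> tlift f t = tlift g t.
Proof. by move=> fg; apply: eq_bigr => p _; apply: fg. Qed.

Lemma tliftB V W X (f g : V -> W -> X) t :
  tlift (fun x y => f x y - g x y) t = tlift f t - tlift g t.
Proof. exact: sumrB. Qed.

Lemma linear_tlift V W X Y (g : {linear X -> Y}) (f : V -> W -> X) t :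
  g (tlift f t) = tlift (fun x y => g (f x y)) t.
Proof. exact: linear_sum. Qed.

(** [tmap F G t] carries an arbitrary representative of its class, so bilinearity
of [f] is what makes the value independent of the choice. *)
Lemma tlift_tmap V V' W W' X (f : V' -> W' -> X) (F : V -> V') (G : W -> W') t :
  bilinear_map f -> tlift f (tmap F G t) = tlift (fun x y => f (F x) (G y)) t.
Proof.
move=> fP; have fl := tlift_linear fP.
pose fL : {linear (V' \ot W')%type -> X} :=
  HB.pack (tlift f) (GRing.isLinear.Build _ _ _ _ _ fl).
rewrite -[tlift f]/(fL : _ -> _) linear_tlift.
by apply: eq_tlift => x y; apply: tlift_pure.
Qed.

Lemma pure_tliftl V W X Y (f : V -> W -> X) t (z : Y) :
  tlift f t \ot z = tlift (fun x y => f x y \ot z) t.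
Proof. exact: linear_sumlz. Qed.

Lemma pure_tliftr V W X Y (f : V -> W -> X) t (z : Y) :
  z \ot tlift f t = tlift (fun x y => z \ot f x y) t.
Proof. exact: linear_sumr. Qed.

(** The expression f(r1, r2, s1, s2), summed over both tensors; all products of
two tensors and all terms of the coassociativity condition have this form. *)
Definition tlift2 V W V' W' X (f : V -> W -> V' -> W' -> X) r s : X :=
  tlift (fun r1 r2 => tlift (f r1 r2) s) r.

Lemma eq_tlift2 V W V' W' X (f g : V -> W -> V' -> W' -> X) r s :
  (forall r1 r2 s1 s2, f r1 r2 s1 s2 = g r1 r2 s1 s2) ->
  tlift2 f r s = tlift2 g r s.
Proof. by move=> fg; do 2!apply: eq_tlift => ? ?. Qed.

Lemma linear_tlift2 V W V' W' X Y (g : {linear X -> Y})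
    (f : V -> W -> V' -> W' -> X) r s :
  g (tlift2 f r s) = tlift2 (fun r1 r2 s1 s2 => g (f r1 r2 s1 s2)) r s.
Proof. by rewrite linear_tlift; apply: eq_tlift => x y; apply: linear_tlift. Qed.

Lemma tlift2_swap V W V' W' X (f : V -> W -> V' -> W' -> X) r s :
  tlift2 f r s = tlift2 (fun s1 s2 r1 r2 => f r1 r2 s1 s2) s r.
Proof. exact: exchange_big. Qed.

(** The form in which invariance is used: a structure map may be inserted on
both legs at once inside any bilinear expression. *)
Lemma tlift_inv V X (F : {linear V -> V}) (f : V -> V -> X) t :
  invariant_tensor F t -> bilinear_map f ->
  tlift f t = tlift (fun x y => f (F x) (F y)) t.
Proof. by move=> Ft fP; rewrite -{1}Ft tlift_tmap. Qed.

Lemma tlift2_invr V W V' X (F : {linear V' -> V'})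
    (f : V -> W -> V' -> V' -> X) r s :
  invariant_tensor F s -> (forall r1 r2, bilinear_map (f r1 r2)) ->
  tlift2 f r s = tlift2 (fun r1 r2 s1 s2 => f r1 r2 (F s1) (F s2)) r s.
Proof. by move=> Fs fP; apply: eq_tlift => r1 r2; apply: tlift_inv. Qed.

Lemma tlift2_invl V V' W' X (F : {linear V -> V})
    (f : V -> V -> V' -> W' -> X) r s :
  invariant_tensor F r ->
  (forall s1 s2, bilinear_map (fun r1 r2 => f r1 r2 s1 s2)) ->
  tlift2 f r s = tlift2 (fun r1 r2 => f (F r1) (F r2)) r s.
Proof.
by move=> Fr fP; rewrite tlift2_swap (tlift2_invr _ Fr)// [LHS]tlift2_swap.
Qed.

End MultilinearExpressions.

Arguments tlift2_invr {K V W V' X F f r s}.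
Arguments tlift2_invl {K V V' W' X F f r s}.

Ltac bilin :=
  intros; split=> ? ? ? ?; rewrite /= ?(linearP, pure_linl, pure_linr)//.

(** The actions apply [tmap] to anonymous functions such as x |-> mu (a (x) x),
whose linearity is available as a proof rather than by unification. *)
Section TmapPredicate.
Context (K : fieldType) (V V' W W' : lmodType K) (f : V -> V') (g : W -> W').
Hypotheses (f_lin : linear f) (g_lin : linear g).
Let fL : {linear V -> V'} := HB.pack f (GRing.isLinear.Build _ _ _ _ _ f_lin).
Let gL : {linear W -> W'} := HB.pack g (GRing.isLinear.Build _ _ _ _ _ g_lin).

Lemma tmap_pure_fun x y : tmap f g (x \ot y) = f x \ot g y.
Proof. exact: (tmap_pure fL gL). Qed.

Lemma tmap_linear_fun : linear (tmap f g).
Proof. exact: (tmap_linear fL gL). Qed.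

End TmapPredicate.

HB.instance Definition _ (K : fieldType) (V V' W W' : lmodType K)
    (f : {linear V -> V'}) (g : {linear W -> W'}) :=
  GRing.isLinear.Build K _ _ _ (tmap f g) (tmap_linear f g).

HB.instance Definition _ (K : fieldType) (V W X : lmodType K) :=
  GRing.isLinear.Build K _ _ _ (@tassoc K V W X) (@tassoc_linear K V W X).

(** * Linearity of the actions *)

Section ActionsLinear.
Context (K : fieldType) (A : lmodType K).
Variables (mu : {linear (A \ot A)%type -> A}).
Variables (alpha beta psi omega : {linear A -> A}).

Lemma left_mul_linear (a : A) : linear (fun x => mu (a \ot x)).
Proof. by move=> c x y; rewrite pure_linr linearP. Qed.

Lemma right_mul_linear (a : A) : linear (fun x => mu (x \ot a)).
Proof. by move=> c x y; rewrite pure_linl linearP. Qed.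

Fact lact2_linear a : linear (lact2 mu beta omega a).
Proof. exact: tmap_linear_fun (left_mul_linear _) (linearP _). Qed.

Fact lact3_linear a : linear (lact3 mu beta omega a).
Proof. exact: tmap_linear_fun (lact2_linear a) (linearP _). Qed.

Fact ract2_linear a : linear ((ract2 mu alpha psi)^~ a).
Proof. exact: tmap_linear_fun (linearP _) (right_mul_linear _). Qed.

Fact ract3_linear a : linear ((ract3 mu alpha psi)^~ a).
Proof. exact: tmap_linear_fun (linearP _) (right_mul_linear _). Qed.

HB.instance Definition _ a :=
  GRing.isLinear.Build K _ _ _ (lact2 mu beta omega a) (lact2_linear a).

HB.instance Definition _ a :=
  GRing.isLinear.Build K _ _ _ (lact3 mu beta omega a) (lact3_linear a).

Lemma lact2_pure a x y :
  lact2 mu beta omega a (x \ot y) = mu (omega a \ot x) \ot beta y.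
Proof. exact: tmap_pure_fun (left_mul_linear _) (linearP _) _ _. Qed.

Lemma lact3_pure a x y z : lact3 mu beta omega a (x \ot y \ot z) =
  mu (omega a \ot x) \ot beta y \ot beta z.
Proof.
rewrite -lact2_pure; exact: tmap_pure_fun (lact2_linear a) (linearP _) _ _.
Qed.

Lemma ract2_pure a x y :
  ract2 mu alpha psi (x \ot y) a = alpha x \ot mu (y \ot psi a).
Proof. exact: tmap_pure_fun (linearP _) (right_mul_linear _) _ _. Qed.

Lemma ract3_pure a x y z : ract3 mu alpha psi (x \ot y \ot z) a =
  alpha x \ot alpha y \ot mu (z \ot psi a).
Proof.
rewrite -[alpha x \ot _]tmap_pure.
exact: tmap_pure_fun (linearP (tmap alpha alpha)) (right_mul_linear _) _ _.
Qed.

(** The tensor is the last argument here, so that the right actions can be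
registered as linear maps. *)
Definition ract2_by a t := ract2 mu alpha psi t a.
Definition ract3_by a t := ract3 mu alpha psi t a.

HB.instance Definition _ a :=
  GRing.isLinear.Build K _ _ _ (ract2_by a) (ract2_linear a).

HB.instance Definition _ a :=
  GRing.isLinear.Build K _ _ _ (ract3_by a) (ract3_linear a).

End ActionsLinear.

(** * Coboundaries are derivations compatible with the structure maps *)

Section Coboundaries.
Context (K : fieldType) (A : lmodType K).
Context (mu : {linear (A \ot A)%type -> A}).
Context (alpha beta psi omega alphaV betaV : {linear A -> A}).
Hypotheses (mu_assoc : bihom_associative mu alpha beta).
Hypotheses (alphaK : cancel alpha alphaV) (alphaVK : cancel alphaV alpha).
Hypotheses (betaK : cancel beta betaV) (betaVK : cancel betaV beta).
Hypothesis psi_alpha : forall a, psi (alpha a) = alpha (psi a).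
Hypothesis psi_beta : forall a, psi (beta a) = beta (psi a).
Hypothesis omega_alpha : forall a, omega (alpha a) = alpha (omega a).
Hypothesis omega_beta : forall a, omega (beta a) = beta (omega a).
Hypothesis psi_omega : forall a, psi (omega a) = omega (psi a).
Hypothesis psiM : forall a b, psi (mu (a \ot b)) = mu (psi a \ot psi b).
Hypothesis omegaM : forall a b, omega (mu (a \ot b)) = mu (omega a \ot omega b).

Implicit Types a b c : A.

Local Notation "x ** y" := (mu (x \ot y)) (at level 38, left associativity).
Local Notation "a |> t" := (lact2 mu beta omega a t) (at level 45).
Local Notation "t <| a" := (ract2 mu alpha psi t a) (at level 45).
Local Notation invariant := (@invariant_tensor K A).
Local Notation d r s := (coboundary mu alpha beta psi omega alphaV betaV r s).

Lemma coboundaryE (r s : A \ot A) a : d r s a =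
  tlift (fun r1 r2 => omega (alphaV a) ** r1 \ot beta r2) r
  - tlift (fun s1 s2 => alpha s1 \ot s2 ** psi (betaV a)) s.
Proof. by []. Qed.

Fact coboundary_linear (r s : A \ot A) : linear (d r s).
Proof.
move=> c a b.
rewrite !coboundaryE scalerBr addrACA -opprD /tlift !scaler_sumr -!big_split /=.
by congr (_ - _); apply: eq_bigr => p _; rewrite !(linearP, pure_linl, pure_linr).
Qed.

HB.instance Definition _ (r s : A \ot A) :=
  GRing.isLinear.Build K _ _ _ (d r s) (coboundary_linear r s).

Let alpha_beta := bihom_alpha_beta mu_assoc.
Let alphaM := bihom_alphaM mu_assoc.
Let betaM := bihom_betaM mu_assoc.
Let mulA := bihom_mulA mu_assoc.

Lemma alphaVM a b : alphaV (a ** b) = alphaV a ** alphaV b.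
Proof. by rewrite -{1}[a]alphaVK -{1}[b]alphaVK -alphaM alphaK. Qed.

Lemma betaVM a b : betaV (a ** b) = betaV a ** betaV b.
Proof. by rewrite -{1}[a]betaVK -{1}[b]betaVK -betaM betaK. Qed.

Lemma comm_inverse (F G GV : A -> A) : cancel G GV -> cancel GV G ->
  (forall a, F (G a) = G (F a)) -> forall a, F (GV a) = GV (F a).
Proof. by move=> GK GVK FG a; rewrite -[LHS]GK -FG GVK. Qed.

Lemma coboundary_comm (F : {linear A -> A}) (r s : A \ot A) :
  (forall a b, F (a ** b) = F a ** F b) ->
  (forall a, F (alpha a) = alpha (F a)) -> (forall a, F (beta a) = beta (F a)) ->
  (forall a, F (psi a) = psi (F a)) -> (forall a, F (omega a) = omega (F a)) ->
  invariant F r -> invariant F s ->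
  forall a, tmap F F (d r s a) = d r s (F a).
Proof.
move=> FM Fa Fb Fp Fo Fr Fs a.
rewrite !coboundaryE linearB /= ![tmap _ _ _]linear_tlift.
congr (_ - _).
  rewrite [RHS](tlift_inv Fr); last by bilin.
  apply: eq_tlift => x y /=.
  by rewrite tmap_pure FM Fo Fb (comm_inverse alphaK alphaVK Fa).
rewrite [RHS](tlift_inv Fs); last by bilin.
apply: eq_tlift => x y /=.
by rewrite tmap_pure FM Fp Fa (comm_inverse betaK betaVK Fb).
Qed.

(** The two contributions of [t] cancel, which is why one identity yields both
the derivation property of the coboundaries and the two formulas for the
comultiplication of a product. *)
Lemma coboundaryM (r s t : A \ot A) : invariant beta r -> invariant alpha s ->
  forall a b, d r s (a ** b) = a |> d r t b + d t s a <| b.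
Proof.
move=> rb sa a b.
rewrite -[_ <| b]/(ract2_by mu alpha psi b _) !coboundaryE !linearB /=.
rewrite ![lact2 _ _ _ _ _]linear_tlift ![ract2_by _ _ _ _ _]linear_tlift.
(* The associativity law puts an extra beta on the first leg of r and an extra
   alpha on the second leg of s; invariance compensates for both. *)
rewrite (tlift_inv rb); last by bilin.
rewrite [X in _ - X = _](tlift_inv sa); last by bilin.
set L := tlift _ r; set M := tlift _ s.
set L' := tlift _ r; set N := tlift _ t; set N' := tlift _ t; set M' := tlift _ s.
have -> : L = L'.
  apply: eq_tlift => x y /=; rewrite lact2_pure alphaVM omegaM -mulA.
  by rewrite -omega_alpha alphaVK.
have -> : M = M'.
  apply: eq_tlift => x y /=; rewrite /ract2_by ract2_pure betaVM psiM mulA.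
  by rewrite -psi_beta betaVK.
have -> : N = N'; last by rewrite addrA subrK.
apply: eq_tlift => x y /=; rewrite lact2_pure /ract2_by ract2_pure.
by rewrite alphaM betaM -omega_alpha -psi_beta alphaVK betaVK.
Qed.

Lemma coboundary_derivation (r : A \ot A) :
  invariant alpha r -> invariant beta r ->
  invariant psi r -> invariant omega r ->
  bihom_derivation mu alpha beta psi omega (d r r).
Proof.
move=> ra rb rp ro; split; first exact: coboundary_linear.
- exact: coboundary_comm.
- exact: coboundary_comm.
- exact: coboundary_comm.
- exact: coboundary_comm.
- exact: coboundaryM.
Qed.

(** * Coassociativity *)

Local Notation m13_12 := (mul13_12 mu alpha beta psi omega).
Local Notation m12_23 := (mul12_23 mu alpha beta).
Local Notation m23_13 := (mul23_13 mu alpha beta psi omega).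

Lemma mul12_23E (r s : A \ot A) : m12_23 r s =
  tlift2 (fun r1 r2 s1 s2 => alpha r1 \ot r2 ** s1 \ot beta s2) r s.
Proof. by []. Qed.

Lemma mul13_12E (r s : A \ot A) : m13_12 r s =
  tlift2 (fun r1 r2 s1 s2 => omega r1 ** s1 \ot beta s2 \ot alpha (psi r2)) r s.
Proof. by []. Qed.

Lemma mul23_13E (r s : A \ot A) : m23_13 r s =
  tlift2 (fun r1 r2 s1 s2 => beta (omega s1) \ot alpha r1 \ot r2 ** psi s2) r s.
Proof. by []. Qed.

Section Coassociativity.
Variables (r s : A \ot A).
Hypotheses (r_alpha : invariant alpha r) (r_beta : invariant beta r).
Hypotheses (r_psi : invariant psi r) (r_omega : invariant omega r).
Hypotheses (s_alpha : invariant alpha s) (s_beta : invariant beta s).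
Hypotheses (s_psi : invariant psi s) (s_omega : invariant omega s).

Local Notation lm a x := (omega (alphaV a) ** x).
Local Notation rm a x := (x ** psi (betaV a)).

Lemma comul_coboundary_left a : tmap (d r s) psi (d r s a) =
  tlift2 (fun r1 r2 t1 t2 => lm (lm a r1) t1 \ot beta t2 \ot psi (beta r2)) r r
  - tlift2 (fun r1 r2 s1 s2 =>
      alpha s1 \ot rm (lm a r1) s2 \ot psi (beta r2)) r s
  - (tlift2 (fun s1 s2 r1 r2 =>
       lm (alpha s1) r1 \ot beta r2 \ot psi (rm a s2)) s r
     - tlift2 (fun s1 s2 t1 t2 =>
         alpha t1 \ot rm (alpha s1) t2 \ot psi (rm a s2)) s s).
Proof.
rewrite [d r s a in LHS]coboundaryE linearB /= ![tmap _ _ _]linear_tlift /=.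
rewrite /tlift2 -!tliftB; congr (_ - _); apply: eq_tlift => x y;
  by rewrite tmap_pure /= coboundaryE linearBl /= !pure_tliftl.
Qed.

Lemma comul_coboundary_right a : tassoc (tmap omega (d r s) (d r s a)) =
  tlift2 (fun r1 r2 t1 t2 =>
    omega (lm a r1) \ot lm (beta r2) t1 \ot beta t2) r r
  - tlift2 (fun r1 r2 s1 s2 =>
      omega (lm a r1) \ot alpha s1 \ot rm (beta r2) s2) r s
  - (tlift2 (fun s1 s2 r1 r2 =>
       omega (alpha s1) \ot lm (rm a s2) r1 \ot beta r2) s r
     - tlift2 (fun s1 s2 t1 t2 =>
         omega (alpha s1) \ot alpha t1 \ot rm (rm a s2) t2) s s).
Proof.
rewrite [d r s a in LHS]coboundaryE linearB /= ![tmap _ _ _]linear_tlift linearB /=.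
rewrite ![tassoc _]linear_tlift /= /tlift2 -!tliftB.
by congr (_ - _); apply: eq_tlift => x y;
  rewrite tmap_pure /= coboundaryE linearBr /= !pure_tliftr linearB /=;
  rewrite ![tassoc _]linear_tlift; congr (_ - _);
  apply: eq_tlift => z w; apply: tassoc_pure.
Qed.

(** Writing a = alpha^2(beta^2(c)) lets all the inverses of alpha and beta in the
expansions below cancel. *)
Lemma root_alpha2_beta2 a : exists c, a = alpha (alpha (beta (beta c))).
Proof. by exists (betaV (betaV (alphaV (alphaV a)))); rewrite !betaVK !alphaVK. Qed.

(* Normal form of iterated structure maps: products outermost, then alpha,
   beta, omega and psi in this order, the inverses being cancelled. *)
Let commE := (alphaM, betaM, psiM, omegaM, alphaVM, betaVM,
  psi_omega, psi_beta, omega_beta, psi_alpha, omega_alpha,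
  fun a => esym (alpha_beta a),
  fun a => esym (comm_inverse betaK betaVK alpha_beta a),
  alphaK, betaK).

(** The next six lemmas identify the non-mixed terms.  In each proof the inserted
maps are read off by comparing the powers of the structure maps that stand on
the legs of the two sides; where the order of the two tensors differs, the sums
are exchanged. *)
Lemma lact_mul13_12 a :
  lact3 mu beta omega (omega (alphaV a)) (m13_12 r r) =
  tlift2 (fun r1 r2 t1 t2 => lm (lm a r1) t1 \ot beta t2 \ot psi (beta r2)) r r.
Proof.
have [c ->] := root_alpha2_beta2 a.
rewrite mul13_12E linear_tlift2 [RHS](tlift2_invl r_alpha); last by bilin.
rewrite [RHS](tlift2_invr r_beta); last by bilin.
apply: eq_tlift2 => r1 r2 t1 t2; rewrite /= lact3_pure.
by rewrite !commE mulA ?commE.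
Qed.

Lemma lact_mul12_23 a :
  lact3 mu beta omega (omega (alphaV a)) (m12_23 r r) =
  tlift2 (fun r1 r2 t1 t2 =>
    omega (lm a r1) \ot lm (beta r2) t1 \ot beta t2) r r.
Proof.
have [c ->] := root_alpha2_beta2 a.
rewrite mul12_23E (tlift2_invl r_omega); last by bilin.
rewrite linear_tlift2 [RHS](tlift2_invl r_alpha); last by bilin.
rewrite [RHS](tlift2_invr r_beta); last by bilin.
apply: eq_tlift2 => r1 r2 t1 t2; rewrite /= lact3_pure.
by rewrite !commE.
Qed.

Lemma lact_mul23_13 a :
  lact3 mu beta omega (omega (alphaV a)) (m23_13 s r) =
  tlift2 (fun r1 r2 s1 s2 =>
    omega (lm a r1) \ot alpha s1 \ot rm (beta r2) s2) r s.
Proof.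
have [c ->] := root_alpha2_beta2 a.
rewrite mul23_13E linear_tlift2 [LHS]tlift2_swap.
rewrite [RHS](tlift2_invl r_beta); last by bilin.
rewrite [RHS](tlift2_invr s_beta); last by bilin.
apply: eq_tlift2 => r1 r2 s1 s2; rewrite /= lact3_pure.
by rewrite !commE.
Qed.

Lemma ract_mul13_12 a :
  ract3 mu alpha psi (m13_12 s r) (psi (betaV a)) =
  tlift2 (fun s1 s2 r1 r2 =>
    lm (alpha s1) r1 \ot beta r2 \ot psi (rm a s2)) s r.
Proof.
have [c ->] := root_alpha2_beta2 a.
rewrite mul13_12E [LHS](linear_tlift2 (ract3_by mu alpha psi _)).
rewrite [RHS](tlift2_invl s_alpha); last by bilin.
rewrite [RHS](tlift2_invr r_alpha); last by bilin.
apply: eq_tlift2 => s1 s2 r1 r2; rewrite /= /ract3_by ract3_pure.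
by rewrite !commE.
Qed.

Lemma ract_mul12_23 a :
  ract3 mu alpha psi (m12_23 s s) (psi (betaV a)) =
  tlift2 (fun s1 s2 t1 t2 =>
    alpha t1 \ot rm (alpha s1) t2 \ot psi (rm a s2)) s s.
Proof.
have [c ->] := root_alpha2_beta2 a.
rewrite mul12_23E (tlift2_invr s_psi); last by bilin.
rewrite [LHS](linear_tlift2 (ract3_by mu alpha psi _)) [LHS]tlift2_swap.
rewrite [RHS](tlift2_invl s_beta); last by bilin.
rewrite [RHS](tlift2_invr s_alpha); last by bilin.
apply: eq_tlift2 => s1 s2 t1 t2; rewrite /= /ract3_by ract3_pure.
by rewrite !commE.
Qed.

Lemma ract_mul23_13 a :
  ract3 mu alpha psi (m23_13 s s) (psi (betaV a)) =
  tlift2 (fun s1 s2 t1 t2 =>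
    omega (alpha s1) \ot alpha t1 \ot rm (rm a s2) t2) s s.
Proof.
have [c ->] := root_alpha2_beta2 a.
rewrite mul23_13E.
rewrite [LHS](linear_tlift2 (ract3_by mu alpha psi _)) [LHS]tlift2_swap.
rewrite [RHS](tlift2_invl s_beta); last by bilin.
rewrite [RHS](tlift2_invr s_alpha); last by bilin.
apply: eq_tlift2 => s1 s2 t1 t2; rewrite /= /ract3_by ract3_pure.
by rewrite !commE mulA ?commE.
Qed.

(** Both terms come down to
alpha^2(omega(s1)) (x) (omega(s2) w) beta(psi(r1)) (x) beta^2(psi(r2)), with w
the image of a under psi and omega and the inverses of alpha and beta. *)
Lemma mixed_terms_cancel a :
  tlift2 (fun r1 r2 s1 s2 =>
    alpha s1 \ot rm (lm a r1) s2 \ot psi (beta r2)) r s =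
  tlift2 (fun s1 s2 r1 r2 =>
    omega (alpha s1) \ot lm (rm a s2) r1 \ot beta r2) s r.
Proof.
have [c ->] := root_alpha2_beta2 a.
rewrite [LHS]tlift2_swap.
rewrite [LHS](tlift2_invr r_beta); last by bilin.
rewrite [LHS](tlift2_invl s_alpha); last by bilin.
rewrite [LHS](tlift2_invl s_omega); last by bilin.
rewrite [RHS](tlift2_invl s_alpha); last by bilin.
rewrite [RHS](tlift2_invr r_beta); last by bilin.
rewrite [RHS](tlift2_invr r_psi); last by bilin.
apply: eq_tlift2 => s1 s2 r1 r2 /=.
by rewrite !commE mulA ?commE.
Qed.

Lemma regroup_terms (V : zmodType) (t1 t3 t4 u1 u2 u4 x : V) :
  t1 - x - (t3 - t4) - (u1 - u2 - (x - u4)) = t1 - u1 + u2 - (t3 - t4 + u4).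
Proof.
rewrite (opprB (u1 - u2)) -[x - u4 - _]addrA [_ - x - _]addrAC subrKA (opprB u1).
rewrite [- u4 + _]addrC -[t1 - u1 + u2]addrA [- u1 + u2]addrC.
by rewrite (opprD _ u4) [RHS]addrACA.
Qed.

(** The equality holds for each a separately, so the equivalence with
coassociativity is pointwise and no quantifier over a has to be exploited: once
the mixed terms cancel, the six remaining terms match with their signs. *)
Lemma coassociativity_defect a :
  tmap (d r s) psi (d r s a) - tassoc (tmap omega (d r s) (d r s a)) =
  lact3 mu beta omega (omega (alphaV a))
    (m13_12 r r - m12_23 r r + m23_13 s r)
  - ract3 mu alpha psi (m13_12 s r - m12_23 s s + m23_13 s s) (psi (betaV a)).
Proof.
rewrite -[ract3 _ _ _ _ _]/(ract3_by mu alpha psi _ _).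
rewrite (linearD (lact3 mu beta omega _)) (linearB (lact3 mu beta omega _)).
rewrite (linearD (ract3_by mu alpha psi _)) (linearB (ract3_by mu alpha psi _)).
rewrite /= /ract3_by.
rewrite lact_mul13_12 lact_mul12_23 lact_mul23_13.
rewrite ract_mul13_12 ract_mul12_23 ract_mul23_13.
rewrite comul_coboundary_left comul_coboundary_right mixed_terms_cancel.
exact: regroup_terms.
Qed.

Lemma comul_coassociative_iff a :
  tmap (d r s) psi (d r s a) = tassoc (tmap omega (d r s) (d r s a)) <->
  lact3 mu beta omega (omega (alphaV a))
    (m13_12 r r - m12_23 r r + m23_13 s r)
  = ract3 mu alpha psi (m13_12 s r - m12_23 s s + m23_13 s s) (psi (betaV a)).
Proof.
split=> /eqP; rewrite -subr_eq0.
  by rewrite coassociativity_defect subr_eq0 => /eqP.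
by rewrite -coassociativity_defect subr_eq0 => /eqP.
Qed.

End Coassociativity.

End Coboundaries.

(** * The equivalence *)

Lemma linear_inverse (K : fieldType) (V W : lmodType K) (f : {linear V -> W})
    (fV : W -> V) :
  cancel f fV -> cancel fV f -> exists g : {linear W -> V}, fV = g.
Proof.
move=> fK fVK; pose fV_lin := can2_linear fK fVK.
pose g : {linear W -> V} :=
  HB.pack fV (GRing.isLinear.Build _ _ _ _ _ fV_lin).
by exists g.
Qed.

Theorem proposition2p26 (K : fieldType) (A : lmodType K)
  (mu : {linear (A \ot A)%type -> A}) (alpha beta psi omega : {linear A -> A})
  (alphaV betaV : A -> A) (r s : A \ot A)
  (mu_assoc : bihom_associative mu alpha beta)
  (alphaK : cancel alpha alphaV) (alphaVK : cancel alphaV alpha)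
  (betaK : cancel beta betaV) (betaVK : cancel betaV beta)
  (psi_alpha : forall a, psi (alpha a) = alpha (psi a))
  (psi_beta : forall a, psi (beta a) = beta (psi a))
  (omega_alpha : forall a, omega (alpha a) = alpha (omega a))
  (omega_beta : forall a, omega (beta a) = beta (omega a))
  (psi_omega : forall a, psi (omega a) = omega (psi a))
  (psiM : forall a b, psi (mu (a \ot b)) = mu (psi a \ot psi b))
  (omegaM : forall a b, omega (mu (a \ot b)) = mu (omega a \ot omega b))
  (r_alpha : invariant_tensor alpha r) (r_beta : invariant_tensor beta r)
  (r_psi : invariant_tensor psi r) (r_omega : invariant_tensor omega r)
  (s_alpha : invariant_tensor alpha s) (s_beta : invariant_tensor beta s)
  (s_psi : invariant_tensor psi s) (s_omega : invariant_tensor omega s) :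
  covariant_bihom_bialgebra mu
    (coboundary mu alpha beta psi omega alphaV betaV r r)
    (coboundary mu alpha beta psi omega alphaV betaV s s)
    (coboundary mu alpha beta psi omega alphaV betaV r s)
    alpha beta psi omega
  <->
  forall a : A,
    lact3 mu beta omega (omega (alphaV a))
      (mul13_12 mu alpha beta psi omega r r - mul12_23 mu alpha beta r r
       + mul23_13 mu alpha beta psi omega s r)
    = ract3 mu alpha psi
        (mul13_12 mu alpha beta psi omega s r - mul12_23 mu alpha beta s s
         + mul23_13 mu alpha beta psi omega s s)
        (psi (betaV a)).
Proof.
have [aV alphaVE] := linear_inverse alphaK alphaVK.
have [bV betaVE] := linear_inverse betaK betaVK; subst alphaV betaV.
have coassocE := comul_coassociative_iff mu_assoc alphaK alphaVK betaK betaVK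
  psi_alpha psi_beta omega_alpha omega_beta psi_omega psiM omegaM
  r_alpha r_beta r_psi r_omega s_alpha s_beta s_psi s_omega.
split=> [[_ _ _ [_ _ _ _ coassoc] _ _ _ _ _ _ _ _ _ _] a|identity].
  exact/coassocE/coassoc.
have alpha_beta := bihom_alpha_beta mu_assoc.
have alphaM := bihom_alphaM mu_assoc; have betaM := bihom_betaM mu_assoc.
split=> //.
- exact: coboundary_derivation.
- exact: coboundary_derivation.
- split=> //; first exact: coboundary_linear.
  + exact: coboundary_comm.
  + exact: coboundary_comm.
  + by move=> a; apply/coassocE.
- by move=> a b; rewrite addrC; apply: coboundaryM.
- by move=> a b; apply: coboundaryM.
- exact: coboundary_comm.
- exact: coboundary_comm.
Qed.
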